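(* (1) The problem $\textsf{HBU}$ $\mu N$-reduces to the problem: for every monotone convergent net in $[0,1]$ indexed by Baire space, there is a modulus of convergence. (2) The Lebesgue number lemma strongly $\mu N$-reduces to the problem: every monotone net in $[0,1]$ indexed by Baire space has a limit.
   Context: Work in the language of higher-order arithmetic: objects of type $0$ are natural numbers, of type $1$ elements of $\mathbb{N}^{\mathbb{N}}$, of type $2$ functionals $\mathbb{N}^{\mathbb{N}}\to\mathbb{N}$. Reals are represented by elements of $\mathbb{N}^{\mathbb{N}}$ (fast-converging Cauchy sequences of rationals) in the standard way so that quantifiers over $\mathbb{R}$ or $[0,1]$ are quantifiers over $\mathbb{N}^{\mathbb{N}}$, and functions $[0,1]\to\mathbb{R}$ are type-2 objects. A ''problem'' is a statement of the form $(\forall Y^{2})(\exists x^{1})A(Y,x)$ (higher-type parameters such as nets or functions are coded as type-2 objects, outputs such as reals, finite sequences of reals or sequences of indices as type-1 objects). For problems $P_A\equiv(\forall Y^{2})(\exists x^{1})A(Y,x)$ and $P_B\equiv(\forall Z^{2})(\exists y^{1})B(Z,y)$, say $P_B$ $\mu N$-reduces to $P_A$ if there are $e\in\mathbb{N}$ and terms $s$, $t$ of Gödel's system $T$ such that $(\forall Z^{2},x^{1})\big[A(t(Z,\mu),x)\to[\{e\}^{s(Z,x)}\downarrow\wedge B(Z,\{e\}^{s(Z,x)})]\big]$, where $\{e\}^{X}$ is the $e$-th Turing machine with oracle $X$ and $\mu^{2}$ is Feferman's search operator: $\mu(f)$ is the least $n$ with $f(n)=0$ if such $n$ exists, and $0$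 otherwise. The reduction is strong if $s(Z,x)$ can be taken as $u(x)$ for a term $u$ of Gödel's $T$ not depending on $Z$. $\textsf{HBU}$ is the problem: for every $\Psi:[0,1]\to\mathbb{R}^{+}$ there are $x_0,\dots,x_k\in[0,1]$ with $[0,1]\subseteq\bigcup_{i\leq k}B(x_i,\Psi(x_i))$, where $B(x,r)$ is the open ball. The Lebesgue number lemma is the problem: for every $\Psi:[0,1]\to\mathbb{R}^{+}$ there is a Lebesgue number $\delta>0$ for the covering $\bigcup_{x\in[0,1]}B(x,\Psi(x))$, i.e.\ every $Y\subseteq[0,1]$ with $\sup_{x,y\in Y}|x-y|<\delta$ is contained in some $B(x,\Psi(x))$. A directed set is a nonempty $D$ with a transitive, reflexive relation $\preceq$ in which any two elements have a common upper bound; a net is a map $x:D\to[0,1]$, written $(x_d)_{d\in D}$; it is indexed by Baire space if $D\subseteq\mathbb{N}^{\mathbb{N}}$; it is monotone (increasing) if $a\preceq b$ implies $x_a\leq x_b$; it converges to $x$ (its limit) if for every $\varepsilon>0$ there is $d_0$ with $|x_e-x|<\varepsilon$ for all $e\succeq d_0$. A modulus of convergence for a net with limit $x$ is a sequence $(d_k)_{k\in\mathbb{N}}$ in $D$ with $(\forall k)(\forall d\succeq d_k)(|x_d-x|<2^{-k})$. *)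

(* Defs.v *)
From Stdlib Require Cantor.
From HB Require Import structures.
From mathcomp Require Import all_boot all_order all_algebra.
From mathcomp Require Import all_classical all_reals all_analysis.

Set Implicit Arguments.
Unset Strict Implicit.
Unset Printing Implicit Defensive.

Import Order.TTheory GRing.Theory Num.Theory.
Import numFieldNormedType.Exports.

Local Open Scope classical_set_scope.
Local Open Scope ring_scope.

Inductive ftype : Type := tN | tArr of ftype & ftype.

(* The full (set-theoretic) type structure over the natural numbers. *)
Fixpoint interp (a : ftype) : Type :=
  match a with
  | tN => nat
  | tArr a b => interp a -> interp b
  end.

Inductive var : seq ftype -> ftype -> Type :=
| Var0 G a : var (a :: G) a
| VarS G a b : var G a -> var (b :: G) a.

Inductive term : seq ftype -> ftype -> Type :=
| TVar G a : var G a -> term G a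
| TLam G a b : term (a :: G) b -> term G (tArr a b)
| TApp G a b : term G (tArr a b) -> term G a -> term G b
| TZero G : term G tN
| TSucc G : term G (tArr tN tN)
| TRec G a :
    term G (tArr a (tArr (tArr tN (tArr a a)) (tArr tN a))).

Fixpoint env (G : seq ftype) : Type :=
  match G with
  | [::] => unit
  | a :: G' => (interp a * env G')%type
  end.

Fixpoint eval_var G a (v : var G a) : env G -> interp a :=
  match v in var G a return env G -> interp a with
  | Var0 _ _ => fun r => r.1
  | VarS _ _ _ v' => fun r => eval_var v' r.2
  end.

(* The recursor satisfies R a f 0 = a and R a f n.+1 = f n (R a f n). *)
Fixpoint eval G a (t : term G a) : env G -> interp a :=
  match t in term G a return env G -> interp a with
  | TVar _ _ v => eval_var v
  | TLam _ _ _ t' => fun r x => eval t' (x, r)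
  | TApp _ _ _ t1 t2 => fun r => eval t1 r (eval t2 r)
  | TZero _ => fun _ => 0%N
  | TSucc _ => fun _ => S
  | TRec _ a => fun _ x f n => nat_rect (fun _ => interp a) x f n
  end.

Definition type1 : ftype := tArr tN tN.
Definition type2 : ftype := tArr type1 tN.

Definition closed_eval a (t : term [::] a) : interp a := eval t tt.

Notation baire := (nat -> nat).
Notation functional2 := ((nat -> nat) -> nat).

Definition feferman_mu (f : baire) : nat :=
  if pselect (exists n, f n == 0%N) is left h then ex_minn h else 0%N.

(* Two-way infinite tape: the cells to the left of the head (nearest first)
   and the cells from the head on; unlisted cells are blank (symbol 0). *)
Definition tape : Type := (seq nat * seq nat)%type.

Definition tape_read (t : tape) : nat := head 0%N t.2.
Definition tape_write (a : nat) (t : tape) : tape := (t.1, a :: behead t.2).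

Definition tape_move (m : option bool) (t : tape) : tape :=
  match m with
  | None => t
  | Some true => (tape_read t :: t.1, behead t.2)
  | Some false => (behead t.1, head 0%N t.1 :: t.2)
  end.

(* Numbers are written in unary, and read off as the number of 1s. *)
Definition tape_of_nat (n : nat) : tape := ([::], nseq n 1%N).
Definition nat_of_tape (t : tape) : nat := count_mem 1%N (t.1 ++ t.2).

(* A machine has a work tape and a query tape.  An instruction
   ((q, a, b), (q', a', b', m, m')) reads: in state q, scanning a on the work
   tape and b on the query tape, go to state q', write a' and b', and move the
   two heads according to m and m'.  The first matching instruction applies. *)
Definition oracle_machine : Type :=
  seq ((nat * nat * nat) * (nat * nat * nat * option bool * option bool)).

Definition config : Type := (nat * tape * tape)%type.

Definition start_state : nat := 0%N.
Definition query_state : nat := 1%N.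
Definition answer_state : nat := 2%N.

(* In the query state the number n on the query tape is replaced by X n.  The
   machine halts (None) when it is not in the query state and no instruction
   applies. *)
Definition machine_step (M : oracle_machine) (X : baire) (c : config) :
    option config :=
  let: (q, w, o) := c in
  if q == query_state then
    Some (answer_state, w, tape_of_nat (X (nat_of_tape o)))
  else
    if ohead [seq ins.2 | ins <- M & ins.1 == (q, tape_read w, tape_read o)]
       is Some (q', a, b, m, m') then
      Some (q', tape_move m (tape_write a w), tape_move m' (tape_write b o))
    else None.

Definition machine_run (M : oracle_machine) (X : baire) (n k : nat) :
    option config :=
  iter k (obind (machine_step M X))
    (Some (start_state, tape_of_nat n, tape_of_nat 0%N)).

Definition machine_outputs (M : oracle_machine) (X : baire) (n m : nat) :
    Prop :=
  exists k c, [/\ machine_run M X n k = Some c, machine_step M X c = None &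
    nat_of_tape c.1.2 = m].

(* {e}^X is defined (total) and equal to y; machines are numbered by the
   library's coding of the countable type oracle_machine. *)
Definition turing_computes (e : nat) (X y : baire) : Prop :=
  exists M : oracle_machine, unpickle e = Some M /\
    forall n, machine_outputs M X n (y n).

(* A stands for the problem (forall Y^2)(exists x^1) A(Y, x). *)
Definition problem : Type := functional2 -> baire -> Prop.

Definition muN_reduces (B A : problem) : Prop :=
  exists (e : nat) (s : term [::] (tArr type2 (tArr type1 type1)))
         (t : term [::] (tArr type2 (tArr type2 type2))),
    forall (Z : functional2) (x : baire),
      A (closed_eval t Z feferman_mu) x ->
      exists y : baire, turing_computes e (closed_eval s Z x) y /\ B Z y.

Definition strongly_muN_reduces (B A : problem) : Prop :=
  exists (e : nat) (u : term [::] (tArr type1 type1))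
         (t : term [::] (tArr type2 (tArr type2 type2))),
    forall (Z : functional2) (x : baire),
      A (closed_eval t Z feferman_mu) x ->
      exists y : baire, turing_computes e (closed_eval u x) y /\ B Z y.

Definition bcons (n : nat) (f : baire) : baire :=
  fun k => if k is k'.+1 then f k' else n.

Definition bjoin (f g : baire) : baire :=
  fun k => if odd k then g k./2 else f k./2.

Definition npair (i j : nat) : nat := Cantor.to_nat (i, j).

(* <<a, b>, c> codes the rational (a - b) / (c + 1). *)
Definition rat_of_code (n : nat) : rat :=
  let: (i, c) := Cantor.of_nat n in
  let: (a, b) := Cantor.of_nat i in
  (a%:R - b%:R) / c.+1%:R.

Definition represents (R : realType) (f : baire) (x : R) : Prop :=
  (forall n i : nat,
     `|rat_of_code (f n) - rat_of_code (f (n + i)%N)| < 2 ^- n) /\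
  ((fun n : nat => ratr (rat_of_code (f n)) : R) @ \oo --> x).

(* A function [0,1] -> R is a map of type 1 -> 1, uncurried to type 2; it acts
   on representations, hence must respect equality of reals. *)
Definition codes_fun (R : realType) (Z : functional2) (Psi : R -> R) : Prop :=
  forall (f : baire) (x : R), x \in `[0, 1] -> represents f x ->
    represents (fun n => Z (bcons n f)) (Psi x).

Definition codes_finseq (R : realType) (y : baire) (k : nat) (x : nat -> R) :
    Prop :=
  y 0%N = k /\
  forall i : nat, (i <= k)%N -> represents (fun n => y (npair i n).+1) (x i).

Definition codes_bseq (y : baire) (d : nat -> baire) : Prop :=
  forall k n : nat, d k n = y (npair k n).

Record net (R : realType) : Type := Net {
  net_index : set baire ;
  net_le : baire -> baire -> Prop ;
  net_val : baire -> R }.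

Definition directed (D : set baire) (le : baire -> baire -> Prop) : Prop :=
  [/\ D !=set0,
      forall a, D a -> le a a,
      forall a b c, D a -> D b -> D c -> le a b -> le b c -> le a c &
      forall a b, D a -> D b -> exists c, [/\ D c, le a c & le b c]].

Definition net_in_unit (R : realType) (N : net R) : Prop :=
  directed (net_index N) (@net_le R N) /\
  forall d, net_index N d -> net_val N d \in `[0, 1].

Definition net_monotone (R : realType) (N : net R) : Prop :=
  forall a b, net_index N a -> net_index N b -> net_le N a b ->
    net_val N a <= net_val N b.

Definition net_limit (R : realType) (N : net R) (l : R) : Prop :=
  forall eps : R, 0 < eps -> exists d0, net_index N d0 /\
    forall d, net_index N d -> net_le N d0 d -> `|net_val N d - l| < eps.

Definition net_modulus (R : realType) (N : net R) (l : R) (d : nat -> baire) :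
    Prop :=
  forall k : nat, net_index N (d k) /\
    forall a, net_index N a -> net_le N (d k) a ->
      `|net_val N a - l| < 2 ^- k.

(* The index set and its preorder are given by characteristic functions, the
   values by representations of reals; the three parts are told apart by the
   first entry of the argument. *)
Definition codes_net (R : realType) (Y : functional2) (N : net R) : Prop :=
  [/\ forall d, net_index N d <-> Y (bcons 0%N d) = 1%N,
      forall a b, net_index N a -> net_index N b ->
        (net_le N a b <-> Y (bcons 1%N (bjoin a b)) = 1%N) &
      forall d, net_index N d ->
        represents (fun n => Y (bcons 2%N (bcons n d))) (net_val N d)].

(* Each problem below constrains its solution only when the input codes an
   object of the required kind. *)
Definition HBU (R : realType) : problem := fun Z y =>
  forall Psi : R -> R, codes_fun Z Psi ->
    (forall x : R, x \in `[0, 1] -> 0 < Psi x) ->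
    exists (k : nat) (x : nat -> R),
      [/\ codes_finseq y k x,
          forall i : nat, (i <= k)%N -> x i \in `[0, 1] &
          [set` `[0, 1]] `<=`
            \bigcup_(i in [set i : nat | (i <= k)%N]) ball (x i) (Psi (x i))].

Definition lebesgue_number (R : realType) (Psi : R -> R) (delta : R) : Prop :=
  0 < delta /\
  forall Y : set R, Y `<=` [set` `[0, 1]] ->
    sup [set `|x - y| | x in Y & y in Y] < delta ->
    exists2 x : R, x \in `[0, 1] & Y `<=` ball x (Psi x).

Definition lebesgue_number_lemma (R : realType) : problem := fun Z y =>
  forall Psi : R -> R, codes_fun Z Psi ->
    (forall x : R, x \in `[0, 1] -> 0 < Psi x) ->
    exists2 delta : R, represents y delta & lebesgue_number Psi delta.

Definition monotone_net_modulus (R : realType) : problem := fun Y x =>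
  forall (N : net R) (l : R), codes_net Y N ->
    net_in_unit N -> net_monotone N -> net_limit N l ->
    exists2 d : nat -> baire, codes_bseq x d & net_modulus N l d.

Definition monotone_net_limit (R : realType) : problem := fun Y x =>
  forall N : net R, codes_net Y N -> net_in_unit N -> net_monotone N ->
    exists2 l : R, represents x l & net_limit N l.

(* Main.v *)
Require Import Defs.
From Stdlib Require Cantor.
From mathcomp Require Import all_boot all_order all_algebra.
From mathcomp Require Import all_classical all_reals all_analysis.
From mathcomp Require Import zify lra.

Set Implicit Arguments.
Unset Strict Implicit.
Unset Printing Implicit Defensive.

Import Order.TTheory GRing.Theory Num.Theory.
Import numFieldNormedType.Exports.

Local Open Scope classical_set_scope.

(** A witness for the covering by the balls B(x, Psi x) is an element w of Baire
    space: w 0 is a precision N, and the rest of w lists binary digits of centres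
    x_j, for j <= 2^N, such that, as approximations of precision 2^-N confirm,
    the ball around x_j contains every point at distance less than 2 * 2^-N from
    j / 2^N.  Every digit sequence is a real in [0,1], so being a witness is
    decided by a term of system T, without any use of mu, and witnesses exist by
    compactness of [0,1].
    Direct the witnesses by decreasing precision and give w the value 2^-(w 0):
    this net is monotone, and it attains its limit at a witness of least
    precision.  Any index of the net, in particular the first entry of a modulus
    of convergence, lists the centres of a finite subcover; and the limit itself
    is a Lebesgue number. *)

(** * Functions definable by terms of system T *)

Definition definable G a (f : env G -> interp a) : Prop :=
  exists t : term G a, forall r, Defs.eval t r = f r.

Arguments definable : clear implicits.

Lemma definable_ext G a (x y : env G -> interp a) :
  (forall r, x r = y r) -> definable G a x -> definable G a y.
Proof. by move=> xy [t tx]; exists t => r; rewrite tx. Qed.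

Lemma definable_app G a b (x : env G -> interp (tArr a b))
    (y : env G -> interp a) :
  definable G (tArr a b) x -> definable G a y ->
  definable G b (fun r => x r (y r)).
Proof. by move=> [t tx] [u uy]; exists (TApp t u) => r /=; rewrite tx uy. Qed.

Lemma definable_app1 G (x : env G -> baire) (n : env G -> nat) :
  definable G type1 x -> definable G tN n ->
  definable G tN (fun r => x r (n r)).
Proof. exact: definable_app. Qed.

Lemma definable_lam G a b (x : env G -> interp a -> interp b) :
  definable (a :: G) b (fun r => x r.2 r.1) -> definable G (tArr a b) x.
Proof.
by move=> [t tx]; exists (TLam t) => r /=; apply: funext => y; rewrite tx.
Qed.

Lemma definable_var G a (v : var G a) : definable G a (eval_var v).
Proof. by exists (TVar v). Qed.

Lemma definable_nat_rect G a (x : env G -> interp a)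
    (f : env G -> nat -> interp a -> interp a) (n : env G -> nat) :
  definable G a x -> definable [:: a, tN & G] a (fun r => f r.2.2 r.2.1 r.1) ->
  definable G tN n ->
  definable G a (fun r => nat_rect (fun=> interp a) (x r) (f r) (n r)).
Proof.
move=> [t tx] [u uf] [v vn].
exists (TApp (TApp (TApp (TRec G a) t) (TLam (TLam u))) v) => r /=.
rewrite tx vn; congr nat_rect.
by apply: funext => i; apply: funext => y; rewrite uf.
Qed.

Lemma definable_succ G (f : env G -> nat) :
  definable G tN f -> definable G tN (fun r => (f r).+1).
Proof. by move=> [t tf]; exists (TApp (TSucc G) t) => r /=; rewrite tf. Qed.

Lemma definable_const G n : definable G tN (fun=> n).
Proof.
elim: n => [|n IHn]; first by exists (TZero G).
exact: definable_succ IHn.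
Qed.

Ltac definable_variable :=
  first [ exact: (definable_var (Var0 _ _))
        | exact: (definable_var (VarS _ (Var0 _ _)))
        | exact: (definable_var (VarS _ (VarS _ (Var0 _ _))))
        | exact: (definable_var (VarS _ (VarS _ (VarS _ (Var0 _ _)))))
        | exact: (definable_var (VarS _ (VarS _ (VarS _ (VarS _ (Var0 _ _))))))
        ].

Section Lift.
Variables (G : seq ftype) (a b c : ftype).

(** Terms over [G] are never weakened, so a definable argument cannot be carried under a binder.
    Abstracting [op] first turns its arguments into variables, which can be. *)
Lemma definable_lift1 (op : interp a -> interp b) (x : env G -> interp a) :
  definable (a :: G) b (fun r => op r.1) ->
  definable G a x -> definable G b (fun r => op (x r)).
Proof.
move=> dop dx; apply: (definable_app (a := a) (b := b) (x := fun=> op)) dx.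
exact: definable_lam.
Qed.

Lemma definable_lift2 (op : interp a -> interp b -> interp c)
    (x : env G -> interp a) (y : env G -> interp b) :
  definable [:: b, a & G] c (fun r => op r.2.1 r.1) ->
  definable G a x -> definable G b y ->
  definable G c (fun r => op (x r) (y r)).
Proof.
move=> dop dx.
apply: (definable_app (a := b) (b := c) (x := fun r => op (x r))).
apply: (definable_app (a := a) (b := tArr b c) (x := fun=> op)) dx.
by do 2 apply: definable_lam.
Qed.

End Lift.

Lemma definable_pred G (f : env G -> nat) :
  definable G tN f -> definable G tN (fun r => (f r).-1).
Proof.
apply: (definable_lift1 (a := tN) (b := tN) (op := predn)).
apply: (definable_ext (a := tN) (x := fun r : env (tN :: G) =>
  nat_rect (fun=> nat) 0%N (fun i _ => i) r.1)); first by move=> r; case: (r.1).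
apply: (definable_nat_rect (a := tN) (f := fun _ i _ => i));
  [exact: definable_const | definable_variable | definable_variable].
Qed.

Lemma definable_add G (f g : env G -> nat) :
  definable G tN f -> definable G tN g ->
  definable G tN (fun r => f r + g r)%N.
Proof.
move=> df dg; apply: (definable_ext (a := tN) (x := fun r =>
  nat_rect (fun=> nat) (f r) (fun _ => S) (g r))).
  by move=> r; elim: (g r) => [|n /= ->]; rewrite ?addn0 ?addnS.
apply: (definable_nat_rect (a := tN) (f := fun _ _ => S)) dg => //.
apply: definable_succ; definable_variable.
Qed.

Lemma definable_sub G (f g : env G -> nat) :
  definable G tN f -> definable G tN g ->
  definable G tN (fun r => f r - g r)%N.
Proof.
move=> df dg; apply: (definable_ext (a := tN) (x := fun r =>
  nat_rect (fun=> nat) (f r) (fun _ => predn) (g r))).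
  by move=> r; elim: (g r) => [|n /= ->]; rewrite ?subn0 ?subnS.
apply: (definable_nat_rect (a := tN) (f := fun _ _ => predn)) dg => //.
apply: definable_pred; definable_variable.
Qed.

Lemma definable_exp2 G (f : env G -> nat) :
  definable G tN f -> definable G tN (fun r => 2 ^ f r)%N.
Proof.
move=> df; apply: (definable_ext (a := tN) (x := fun r =>
  nat_rect (fun=> nat) 1%N (fun _ x => x + x)%N (f r))).
  by move=> r; elim: (f r) => [|n /= ->]; rewrite ?expnS ?mul2n ?addnn.
apply: (definable_nat_rect (a := tN) (f := fun _ _ x => (x + x)%N)) df.
  exact: definable_const.
by apply: definable_add; definable_variable.
Qed.

Lemma definable_mul G (f g : env G -> nat) :
  definable G tN f -> definable G tN g ->
  definable G tN (fun r => f r * g r)%N.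
Proof.
apply: (definable_lift2 (a := tN) (b := tN) (c := tN) (op := muln)).
apply: (definable_ext (a := tN) (x := fun r : env [:: tN, tN & G] =>
  nat_rect (fun=> nat) 0%N (fun _ x => x + r.2.1)%N r.1)).
  move=> r; elim: (r.1) => [|n /= ->]; first by rewrite muln0.
  by rewrite mulnS addnC.
apply: (definable_nat_rect (a := tN) (G := [:: tN, tN & G])
  (x := fun=> 0%N) (f := fun r _ x => (x + r.2.1)%N) (n := fst)).
- exact: definable_const.
- by apply: definable_add; definable_variable.
- definable_variable.
Qed.

Lemma definable_if0 G (f g h : env G -> nat) :
  definable G tN f -> definable G tN g -> definable G tN h ->
  definable G tN (fun r => if f r == 0%N then g r else h r).
Proof.
(* With truncated subtraction, [1 - f r] is 1 if [f r] vanishes and 0 otherwise. *)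
move=> df dg dh; apply: (definable_ext (a := tN) (x := fun r =>
  (1 - f r) * g r + (1 - (1 - f r)) * h r)%N).
  move=> r; case: (f r) => [|n] /=.
    by rewrite subn0 subnn mul1n mul0n addn0.
  by rewrite subSS sub0n subn0 mul0n mul1n.
by do ?[exact: definable_const | assumption | apply: definable_add
       | apply: definable_mul | apply: definable_sub].
Qed.

Lemma definable_npair G (f g : env G -> nat) :
  definable G tN f -> definable G tN g ->
  definable G tN (fun r => npair (f r) (g r)).
Proof.
(* This is [Cantor.to_nat] itself, up to conversion: the second component plus a triangular
   number. *)
move=> df dg; apply: (definable_ext (a := tN) (x := fun r => g r +
  nat_rect (fun=> nat) 0%N (fun i m => i.+1 + m)%N (g r + f r))%N); first by [].
apply: definable_add => //.
apply: (definable_nat_rect (a := tN) (f := fun _ i m => (i.+1 + m)%N)).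
- exact: definable_const.
- by apply: definable_add; [apply: definable_succ|]; definable_variable.
- exact: definable_add.
Qed.

(** The types have no products, so the recursion that walks along the Cantor enumeration carries its
    pair as the values at 0 and 1 of an element of Baire space; [b] selects the component. *)
Lemma definable_of_nat G (f b : env G -> nat) :
  definable G tN f -> definable G tN b ->
  definable G tN (fun r => let: (x, y) := Cantor.of_nat (f r) in
                           if b r == 0%N then x else y).
Proof.
pose step (p : baire) (b : nat) : nat :=
  if p 0%N == 0%N then if b == 0%N then (p 1%N).+1 else 0%N
  else if b == 0%N then (p 0%N).-1 else (p 1%N).+1.
move=> df db; apply: (definable_ext (a := tN) (x := fun r =>
  nat_rect (fun=> baire) (fun=> 0%N) (fun _ => step) (f r) (b r))).
  move=> r; elim: (f r) (b r) => [|n IHn] m /=; first by case: (m == 0%N).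
  by rewrite {1}/step !IHn /=; case: Cantor.of_nat => [[|x] y].
apply: (definable_app (a := tN) (b := tN) (x := fun r =>
  nat_rect (fun=> baire) (fun=> 0%N) (fun _ => step) (f r))) db.
apply: (definable_nat_rect (a := type1) (f := fun _ _ => step)) df.
  by apply: definable_lam; apply: definable_const.
have dp n : definable [:: tN, type1, tN & G] tN (fun r => r.2.1 n).
  apply definable_app1; [definable_variable | exact: definable_const].
apply: (definable_lam (b := tN)); rewrite /step /=.
have db : definable [:: tN, type1, tN & G] tN (fun r => r.1).
  definable_variable.
do !apply: definable_if0 => //; do ?apply: definable_succ => //.
- exact: definable_const.
- exact: definable_pred.
Qed.

Lemma definable_of_nat1 G (f : env G -> nat) :
  definable G tN f -> definable G tN (fun r => (Cantor.of_nat (f r)).1).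
Proof.
move=> df.
apply: definable_ext (definable_of_nat df (definable_const G 0)) => r.
by case: Cantor.of_nat.
Qed.

Lemma definable_of_nat2 G (f : env G -> nat) :
  definable G tN f -> definable G tN (fun r => (Cantor.of_nat (f r)).2).
Proof.
move=> df.
apply: definable_ext (definable_of_nat df (definable_const G 1)) => r.
by case: Cantor.of_nat.
Qed.

Lemma definable_bcons G (f : env G -> nat) (x : env G -> baire) :
  definable G tN f -> definable G type1 x ->
  definable G type1 (fun r => bcons (f r) (x r)).
Proof.
apply: (definable_lift2 (a := tN) (b := type1) (c := type1) (op := bcons)).
apply: (definable_lam (b := tN)).
apply: (definable_ext (a := tN) (x := fun r : env [:: tN, type1, tN & G] =>
  if r.1 == 0%N then r.2.2.1 else r.2.1 r.1.-1)); first by case=> [[|n]] [].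
apply: definable_if0; try definable_variable.
apply definable_app1; first by definable_variable.
by apply: definable_pred; definable_variable.
Qed.

(** * Cover witnesses, the code of their net, and the extraction of a cover *)

Fixpoint digit_prefix (f : baire) (n : nat) : nat :=
  if n is m.+1 then ((digit_prefix f m).*2 + (0 < f m))%N else 0%N.

(** Nonzero entries count as the digit 1, so every sequence is an admissible expansion. The
    denominator is stored less one, as [rat_of_code] expects. *)
Definition digits_code (f : baire) (n : nat) : nat :=
  npair (npair (digit_prefix f n) 0) (2 ^ n).-1.

Definition center_digits (w : baire) (j : nat) : baire :=
  fun n => w (npair j n).+1.

(* Vanishes iff (|j - m| + 4) / 2^N < q, where m / 2^N and q are the
   approximations of precision 2^-N to the j-th centre and to its radius. *)
Definition excess (Z : functional2) (w : baire) (j : nat) : nat :=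
  let N := w 0%N in
  let m := digit_prefix (center_digits w j) N in
  let q := Z (bcons N (digits_code (center_digits w j))) in
  let ab := Cantor.of_nat (Cantor.of_nat q).1 in
  (* Denominators are cleared and the negative part of [q] is moved to the left, since subtraction
     is truncated; the [+ 1] makes vanishing a strict inequality. *)
  (((j - m) + (m - j) + 4) * (Cantor.of_nat q).2.+1 + ab.2 * 2 ^ N + 1
    - ab.1 * 2 ^ N)%N.

(** A sum vanishes iff all its terms do, which expresses the bounded quantifier over [j]; the outer
    subtraction gives the value 1 by which [codes_net] recognises an index. *)
Definition cover_witness (Z : functional2) (w : baire) : nat :=
  (1 - \sum_(j < (2 ^ w 0).+1) excess Z w j)%N.

(** In the order query, positions 1 and 2 hold the precisions [a 0] and [b 0]. In the value query
    they hold the requested place and the precision [d 0]; the answer is the same rational at every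
    place. *)
Definition cover_net_code (Z : functional2) (f : baire) : nat :=
  if f 0%N == 0%N then cover_witness Z (fun n => f n.+1)
  else if (f 0%N).-1 == 0%N then 1 - (f 2 - f 1)
  else npair (npair 1 0) (2 ^ f 2%N).-1.

(** Here [w] is the first entry of the modulus. The output follows [codes_finseq], whose entry 0 is
    the last index [2 ^ w 0], not the length. *)
Definition cover_of_modulus (x : baire) (m : nat) : nat :=
  let w n := x (npair 0 n) in
  if m == 0%N then (2 ^ w 0)%N
  else let jn := Cantor.of_nat m.-1 in digits_code (center_digits w jn.1) jn.2.

(** * Definability of the coding functions *)

Lemma definable_digit_prefix G (x : env G -> baire) (f : env G -> nat) :
  definable G type1 x -> definable G tN f ->
  definable G tN (fun r => digit_prefix (x r) (f r)).
Proof.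
apply: (definable_lift2 (a := type1) (b := tN) (c := tN) (op := digit_prefix)).
pose step (r : env [:: tN, type1 & G]) (i m : nat) : nat :=
  (m + m + (1 - (1 - r.2.1 i)))%N.
apply: (definable_ext (a := tN) (x := fun r : env [:: tN, type1 & G] =>
  nat_rect (fun=> nat) 0%N (step r) r.1)).
  move=> r; elim: (r.1) => [|n /= ->] //; rewrite /step addnn; congr addn.
  by case: (r.2.1 n) => // m; rewrite subSS sub0n.
apply: (definable_nat_rect (a := tN) (G := [:: tN, type1 & G])
  (x := fun=> 0%N) (f := step) (n := fst)); last by definable_variable.
  exact: definable_const.
apply: definable_add; first by apply: definable_add; definable_variable.
do 2?apply: definable_sub; try exact: definable_const.
by apply definable_app1; definable_variable.
Qed.

Lemma definable_digits_code G (x : env G -> baire) :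
  definable G type1 x -> definable G type1 (fun r => digits_code (x r)).
Proof.
apply: (definable_lift1 (a := type1) (b := type1) (op := digits_code)).
apply: (definable_lam (b := tN)); rewrite /digits_code /=.
have dn : definable [:: tN, type1 & G] tN fst by definable_variable.
apply: definable_npair; last exact/definable_pred/definable_exp2.
apply: definable_npair; last exact: definable_const.
exact: definable_digit_prefix (definable_var (VarS _ (Var0 _ _))) dn.
Qed.

Lemma definable_center_digits G (w : env G -> baire) (j : env G -> nat) :
  definable G type1 w -> definable G tN j ->
  definable G type1 (fun r => center_digits (w r) (j r)).
Proof.
apply: (definable_lift2 (a := type1) (b := tN) (c := type1)
  (op := center_digits)).
apply: (definable_lam (b := tN)); rewrite /center_digits /=.
apply definable_app1; first by definable_variable.
by apply/definable_succ/definable_npair; definable_variable.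
Qed.

Lemma definable_excess G (Z : env G -> functional2) (w : env G -> baire)
    (j : env G -> nat) :
  definable G type2 Z -> definable G type1 w -> definable G tN j ->
  definable G tN (fun r => excess (Z r) (w r) (j r)).
Proof.
move=> dZ dw dj.
have dN : definable G tN (fun r => w r 0%N).
  exact: definable_app dw (definable_const G 0).
have dc := definable_center_digits dw dj.
have dm := definable_digit_prefix dc dN.
have dq := definable_app dZ (definable_bcons dN (definable_digits_code dc)).
have dq1 := definable_of_nat1 dq.
rewrite /excess; apply: definable_sub.
  do 2?apply: definable_add; try exact: definable_const; last first.
    by apply: definable_mul; [exact: definable_of_nat2 | exact: definable_exp2].
  apply: definable_mul; last exact/definable_succ/definable_of_nat2.
  apply: definable_add; last exact: definable_const.
  by apply: definable_add; exact: definable_sub.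
by apply: definable_mul; [exact: definable_of_nat1 | exact: definable_exp2].
Qed.

Lemma definable_cover_witness G (Z : env G -> functional2)
    (w : env G -> baire) :
  definable G type2 Z -> definable G type1 w ->
  definable G tN (fun r => cover_witness (Z r) (w r)).
Proof.
apply: (definable_lift2 (a := type2) (b := type1) (c := tN)).
apply: definable_sub; first exact: definable_const.
apply: (definable_ext (a := tN) (x := fun r : env [:: type1, type2 & G] =>
  nat_rect (fun=> nat) 0%N (fun j s => s + excess r.2.1 r.1 j)%N
    (2 ^ r.1 0%N).+1)).
  move=> r; elim: (2 ^ r.1 0%N).+1 => [|n /= ->]; first by rewrite big_ord0.
  by rewrite big_ord_recr.
apply: (definable_nat_rect (a := tN) (G := [:: type1, type2 & G])
  (x := fun=> 0%N) (f := fun r j s => (s + excess r.2.1 r.1 j)%N)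
  (n := fun r => (2 ^ r.1 0%N).+1)).
- exact: definable_const.
- by apply: definable_add; [|apply: definable_excess]; definable_variable.
- apply/definable_succ/definable_exp2; apply definable_app1.
    by definable_variable.
  exact: definable_const.
Qed.

Lemma cover_net_code_term :
  exists t : term [::] (tArr type2 (tArr type2 type2)),
  forall Z mu, closed_eval t Z mu = cover_net_code Z.
Proof.
suff [t tE] : definable [::] (tArr type2 (tArr type2 type2))
    (fun _ Z _ => cover_net_code Z).
  by exists t => Z mu; rewrite /closed_eval tE.
apply: (definable_lam (b := tArr type2 type2)).
apply: (definable_lam (b := type2)); apply: (definable_lam (b := tN)).
rewrite /cover_net_code /=.
have df n : definable [:: type1; type2; type2] tN (fun r => r.1 n).
  by apply definable_app1; [definable_variable|exact: definable_const].
apply: definable_if0 => //; last first.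
  apply: definable_if0; first exact: definable_pred.
    by apply: definable_sub; [exact: definable_const | exact: definable_sub].
  apply: definable_npair; last exact/definable_pred/definable_exp2.
  exact: definable_const.
apply: definable_cover_witness; first by definable_variable.
apply: (definable_lam (b := tN)); apply definable_app1.
  by definable_variable.
by apply: definable_succ; definable_variable.
Qed.

Lemma cover_of_modulus_term :
  exists s : term [::] (tArr type2 (tArr type1 type1)),
  forall Z x, closed_eval s Z x = cover_of_modulus x.
Proof.
suff [t tE] : definable [::] (tArr type2 (tArr type1 type1))
    (fun _ _ x => cover_of_modulus x).
  by exists t => Z x; rewrite /closed_eval tE.
apply: (definable_lam (b := tArr type1 type1)).
apply: (definable_lam (b := type1)); apply: (definable_lam (b := tN)).
rewrite /cover_of_modulus /=.
have dm : definable [:: tN; type1; type2] tN fst by definable_variable.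
apply: definable_if0 => //.
  apply: definable_exp2; apply definable_app1; first by definable_variable.
  exact: definable_const.
have dp := definable_pred dm.
apply (definable_app1 (G := [:: tN; type1; type2]) (x := fun r =>
  digits_code (center_digits (fun n => r.2.1 (npair 0 n))
                             (Cantor.of_nat r.1.-1).1)));
  last exact: definable_of_nat2.
apply/definable_digits_code/definable_center_digits;
  last exact: definable_of_nat1.
apply: (definable_lam (b := tN)); apply definable_app1.
  by definable_variable.
by apply: definable_npair; [exact: definable_const | definable_variable].
Qed.

(** * A Turing machine that copies its oracle *)

(* Moves the input to the query tape and the answer back to the work tape, so
   that it computes its own oracle. *)
Definition lookup_machine : oracle_machine :=
  [:: ((0, 1, 0), (0, 0, 1, Some true, Some true));
      ((0, 0, 0), (query_state, 0, 0, None, None));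
      ((answer_state, 0, 1), (answer_state, 1, 0, Some true, Some true))]%N.

(** Each step trades a 1 on the work tape for a 1 on the query tape. Numbers are read off by
    counting 1s, so the induction tracks only the counts to the left of the heads. *)
Lemma lookup_write_query X n l o : exists l2 v,
  [/\ iter n (obind (machine_step lookup_machine X))
        (Some (0%N, (l, nseq n 1%N), (o, [::]))) =
        Some (0%N, (l2, [::]), (v, [::])),
      count_mem 1%N l2 = count_mem 1%N l &
      count_mem 1%N v = (n + count_mem 1%N o)%N].
Proof.
elim: n l o => [|n IHn] l o; first by exists l, o.
have [l2 [v [run l2E vE]]] := IHn (0%N :: l) (1%N :: o).
exists l2, v; rewrite iterSr; split; first exact: run.
  exact: l2E.
by rewrite vE /= add1n addnS.
Qed.

(** The right part [w] is empty or a single blank: entering the query state writes a 0 without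
    moving, and the first move to the right leaves nothing. *)
Lemma lookup_write_answer X n l w o : head 0%N w = 0%N -> behead w = [::] ->
  exists c, [/\ iter n (obind (machine_step lookup_machine X))
        (Some (answer_state, (l, w), (o, nseq n 1%N))) = Some c,
      machine_step lookup_machine X c = None &
      nat_of_tape c.1.2 = (n + count_mem 1%N l)%N].
Proof.
elim: n l w o => [|n IHn] l w o w0 bw.
  exists (answer_state, (l, w), (o, [::])); split => //.
    by rewrite /machine_step /= /tape_read w0.
  rewrite /nat_of_tape /= count_cat; case: w w0 bw => [|a [|//]] /=.
    by rewrite addn0.
  by move=> -> _; rewrite /= !addn0.
have [c [run stop cE]] := IHn (1%N :: l) [::] (0%N :: o) erefl erefl.
exists c; rewrite iterSr; split => //; last by rewrite cE /= add1n addnS.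
by rewrite -run /= /tape_read /= w0 /tape_move /tape_write /tape_read /= bw.
Qed.

Lemma lookup_machineP X : turing_computes (pickle lookup_machine) X X.
Proof.
exists lookup_machine; split=> [|n]; first exact: pickleK.
have [l [v [run1 lE vE]]] := lookup_write_query X n [::] [::].
have [c [run2 stop cE]] :=
  @lookup_write_answer X (X n) l [:: 0%N] [::] erefl erefl.
(* From right to left: [n] steps write the query, two enter the query state and receive the answer,
   and [X n] copy it. *)
exists (X n + 2 + n)%N, c; split => //; last by rewrite cE lE addn0.
rewrite /machine_run !iterD run1 -run2; congr iter.
by rewrite /= /nat_of_tape /= count_cat vE /= !addn0.
Qed.

Local Open Scope ring_scope.

(** * Binary digits and representations of reals *)

Lemma digit_prefix_bounds (f : baire) (n i : nat) :
  (digit_prefix f n * 2 ^ i <= digit_prefix f (n + i) <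
   (digit_prefix f n).+1 * 2 ^ i)%N.
Proof.
elim: i => [|i /andP[IHl IHr]]; first by rewrite addn0 expn0 !muln1 leqnn /=.
rewrite addnS /= expnS; case: (0 < f _)%N; lia.
Qed.

Lemma rat_of_digits_code (f : baire) (n : nat) :
  rat_of_code (digits_code f n) = (digit_prefix f n)%:R / 2 ^+ n.
Proof.
rewrite /rat_of_code /digits_code /npair !Cantor.cancel_of_to subr0.
by rewrite prednK ?expn_gt0// natrX.
Qed.

Section Digits.
Variable R : realType.
Implicit Types (f : baire) (x : R).

Lemma represents_dist f x n :
  represents f x -> `|ratr (rat_of_code (f n)) - x| <= 2 ^- n.
Proof.
move=> [fC fx]; have : (fun i => `|ratr (rat_of_code (f n)) -
    ratr (rat_of_code (f (i + n)%N))| : R) @ \oo -->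
    `|ratr (rat_of_code (f n)) - x|.
  apply: cvg_norm; apply: cvgB; first exact: cvg_cst.
  by rewrite (cvg_shiftn n (fun i => ratr (rat_of_code (f i)) : R)).
move=> /cvgr_to_le; apply; apply: nearW => i.
rewrite -rmorphB -ratr_norm addnC ltW//.
have -> : 2 ^- n = ratr (2 ^- n) :> R.
  by rewrite fmorphV rmorphXn /= rmorph_nat.
by rewrite ltr_rat fC.
Qed.

(** The Cauchy condition holds for any digits, strictly, by [digit_prefix_bounds]; the hypothesis
    serves for the convergence. *)
Lemma represents_digits_code f x :
  (forall n, `|(digit_prefix f n)%:R / 2 ^+ n - x| <= 2 ^- n) ->
  represents (digits_code f) x.
Proof.
move=> fx; split=> [n i|].
  have /andP[] := digit_prefix_bounds f n i.
  rewrite !rat_of_digits_code -(ler_nat rat) -(ltr_nat rat) !natrM !natrX.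
  rewrite -[(digit_prefix f n).+1%:R]natr1 => lb ub.
  have n0 : (0 : rat) < 2 ^+ n by rewrite exprn_gt0.
  have i0 : (0 : rat) < 2 ^+ i by rewrite exprn_gt0.
  rewrite exprD invfM mulrA mulrAC -mulrBl normrM normfV (gtr0_norm n0).
  rewrite ltr_pdivrMr// mulVf ?lt0r_neq0//.
  have : (digit_prefix f n)%:R <= (digit_prefix f (n + i))%:R / 2 ^+ i :> rat.
    by rewrite ler_pdivlMr.
  have : (digit_prefix f (n + i))%:R / 2 ^+ i <
      (digit_prefix f n)%:R + 1 :> rat.
    by rewrite ltr_pdivrMr.
  by rewrite ltr_norml; lra.
apply/cvgrPdist_lt => e e0.
have := near_infty_natSinv_expn_lt (PosNum e0).
apply: filterS => n /= ne; rewrite rat_of_digits_code.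
rewrite fmorph_div rmorphXn /= !rmorph_nat distrC.
by rewrite (le_lt_trans (fx n))// -div1r.
Qed.

(** The dyadic prefixes increase, and all later ones stay within 2^-n of the n-th; the case n = 0
    puts the limit in the unit interval. *)
Lemma digits_code_real f :
  exists2 x : R, x \in `[0, 1] & represents (digits_code f) x.
Proof.
pose u n : R := (digit_prefix f n)%:R / 2 ^+ n.
have n0 n : (0 : R) < 2 ^+ n by rewrite exprn_gt0.
have ub n i : u n <= u (n + i)%N <= u n + 2 ^- n.
  have /andP[] := digit_prefix_bounds f n i.
  rewrite -(ler_nat R) -(ltr_nat R) !natrM !natrX.
  rewrite -[(digit_prefix f n).+1%:R]natr1 => lb /ltW ub.
  rewrite /u exprD invfM mulrA mulrAC -[X in _ + X]mul1r -mulrDl.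
  by rewrite !ler_pM2r ?invr_gt0// ler_pdivlMr// lb ler_pdivrMr.
have u_nd : nondecreasing_seq u.
  by move=> n m /subnKC <-; case/andP: (ub n (m - n)%N).
have u_cvg : cvgn u.
  apply: nondecreasing_is_cvgn => //; exists 1 => _ [n _ <-].
  by have /andP[_] := ub 0%N n; rewrite /u /= mul0r add0r expr0 invr1.
have le_lim n : u n <= limn u by exact: nondecreasing_cvgn_le.
have lim_le n : limn u <= u n + 2 ^- n.
  apply: limr_le => //; exists n => // m /= /subnKC <-.
  by case/andP: (ub n (m - n)%N).
exists (limn u).
  rewrite in_itv /=; have := lim_le 0%N; have := le_lim 0%N.
  by rewrite /u /= mul0r add0r expr0 invr1 => -> ->.
apply: represents_digits_code => n; rewrite -/(u n).
by rewrite ler_norml; have := lim_le n; have := le_lim n; lra.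
Qed.

Lemma real_digits_code x :
  x \in `[0, 1] -> exists f, represents (digits_code f) x.
Proof.
rewrite in_itv /= => /andP[x0 x1].
(* Greedy expansion, with the invariant A n <= x 2^n <= A n + 1. The upper bound is weak so that x =
   1 is covered, by the digits that are all 1. *)
pose bit n m : bool := (m.*2 + 1)%N%:R <= x * 2 ^+ n.+1.
pose A := nat_rect (fun=> nat) 0%N (fun n m => (m.*2 + bit n m)%N).
exists (fun n => bit n (A n)).
have AE n : digit_prefix (fun n => bit n (A n)) n = A n.
  by elim: n => //= n ->; case: (bit n _).
apply: represents_digits_code => n; rewrite AE.
have n0 m : (0 : R) < 2 ^+ m by rewrite exprn_gt0.
have : (A n)%:R <= x * 2 ^+ n <= (A n)%:R + 1.
  elim: n => [|n /andP[lb ub]]; first by rewrite /= expr0 mulr1 x0 add0r x1.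
  rewrite /= -/(A n) natrD exprS mulrCA -mul2n natrM.
  have : bit n (A n) = (2 * (A n)%:R + 1 <= 2 * (x * 2 ^+ n)).
    by rewrite /bit natrD -mul2n natrM exprS mulrCA.
  by case: (bit n (A n)) => /esym; [|move/negbT; rewrite -ltNge] => /=; lra.
move=> /andP[]; rewrite -ler_pdivrMr// => lb.
rewrite -ler_pdivlMr// mulrDl mul1r => ub.
by rewrite ler_norml; lra.
Qed.

End Digits.

(** * Witnesses and coverings of the unit interval *)

Section Cover.
Variable R : realType.
Implicit Types (Z : functional2) (w : baire) (Psi : R -> R).

Lemma natr_dist (j m : nat) : ((j - m) + (m - j))%N%:R = `|j%:R - m%:R| :> R.
Proof.
have [le_jm|/ltnW le_mj] := leqP j m.
  rewrite (eqP le_jm) add0n natrB// ler0_norm ?opprB//.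
  by rewrite subr_le0 ler_nat.
by rewrite (eqP le_mj) addn0 natrB// ger0_norm// subr_ge0 ler_nat.
Qed.

Lemma excess_eq0 Z w (j : nat) :
  (excess Z w j == 0%N) =
  ((`|j%:R - (digit_prefix (center_digits w j) (w 0%N))%:R| + 4) / 2 ^+ w 0%N <
   ratr (rat_of_code
     (Z (bcons (w 0%N) (digits_code (center_digits w j))))) :> R).
Proof.
rewrite /excess /rat_of_code; set m := digit_prefix _ _.
case: Cantor.of_nat => i c /=; case: Cantor.of_nat => a b /=.
rewrite subn_eq0 addn1 -(ltr_nat R) natrD !natrM natrD natr_dist natrX.
rewrite fmorph_div rmorphB !rmorph_nat /=.
have n0 : (0 : R) < 2 ^+ w 0%N by rewrite exprn_gt0.
have c0 : (0 : R) < c.+1%:R by [].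
by rewrite ltr_pdivrMr// mulrAC ltr_pdivlMr// mulrBl ltrBrDr.
Qed.

(** The 4 in [excess] is a budget in units of 2^-N: 2 for the distance from z to the grid point, 1
    for the error of the approximate centre and 1 for that of the approximate radius. *)
Lemma cover_witness_ball Z Psi w (j : nat) :
  codes_fun Z Psi -> cover_witness Z w = 1%N -> (j <= 2 ^ w 0)%N ->
  exists x : R, [/\ x \in `[0, 1],
    represents (digits_code (center_digits w j)) x &
    forall z : R, `|z - j%:R / 2 ^+ w 0%N| < 2 / 2 ^+ w 0%N ->
      ball x (Psi x) z].
Proof.
move=> ZPsi wP jN; have [x x01 xj] := digits_code_real R (center_digits w j).
exists x; split => // z zj.
have : excess Z w j = 0%N.
  have /eqP : (\sum_(j < (2 ^ w 0).+1) excess Z w j = 0)%N.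
    by move: wP; rewrite /cover_witness; lia.
  rewrite sum_nat_eq0.
  by move=> /forallP/(_ (Ordinal (jN : (j < (2 ^ w 0).+1)%N)))/eqP.
move/eqP; rewrite excess_eq0.
have := represents_dist (w 0%N) (ZPsi _ _ x01 xj).
have := represents_dist (w 0%N) xj.
rewrite rat_of_digits_code fmorph_div rmorphXn /= !rmorph_nat.
set m := (digit_prefix _ _)%:R; set q := ratr _; set e := 2 ^+ w 0%N in zj *.
have e0 : 0 < e by rewrite exprn_gt0.
have -> : (`|j%:R - m| + 4) / e = `|j%:R / e - m / e| + 4 / e.
  by rewrite mulrDl -mulrBl normrM normfV (gtr0_norm e0).
rewrite -ball_normE /= => xm qPsi jq.
have := ler_distD (j%:R / e) x z; have := ler_distD (m / e) x (j%:R / e).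
have qPsi' := ler_norm (q - Psi x).
rewrite [`|x - m / e|]distrC [`|j%:R / e - z|]distrC.
rewrite [`|m / e - j%:R / e|]distrC.
lra.
Qed.

Lemma dyadic_grid (z : R) (n : nat) : z \in `[0, 1] ->
  exists2 j : nat, (j <= 2 ^ n)%N & `|z - j%:R / 2 ^+ n| <= 2 ^- n.
Proof.
rewrite in_itv /= => /andP[z0 z1].
have e0 : (0 : R) < 2 ^+ n by rewrite exprn_gt0.
have : 0 <= z * 2 ^+ n by rewrite mulr_ge0// ltW.
move=> /truncn_itv; set j := Num.truncn _ => /andP[jz zj].
exists j.
  by rewrite -(ler_nat R) natrX (le_trans jz)// ler_piMl// ltW.
have {}jz : j%:R / 2 ^+ n <= z by rewrite ler_pdivrMr.
have {}zj : z <= j%:R / 2 ^+ n + 2 ^- n.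
  by rewrite -[X in _ + X]mul1r -mulrDl ler_pdivlMr// natr1 ltW.
by rewrite ler_norml; lra.
Qed.

Lemma cover_witness_exists Z Psi : codes_fun Z Psi ->
  (forall x : R, x \in `[0, 1] -> 0 < Psi x) ->
  exists w, cover_witness Z w = 1%N.
Proof.
move=> ZPsi Psi0.
(* A uniform precision, by compactness. The 6 is the 4 of [excess] plus one unit each for
   approximating the centre and the radius. *)
have [N PN] : exists N : nat, forall y : R, y \in `[0, 1] ->
    exists2 x : R, x \in `[0, 1] & `|y - x| + 6 / 2 ^+ N < Psi x.
  have /compact_near_coveringP cpt := @segment_compact R 0 1.
  suff /filter_ex[N PN] : \forall N \near \oo, `[0, 1]%classic `<=`
      [set y | exists2 x : R, x \in `[0, 1] & `|y - x| + 6 / 2 ^+ N < Psi x].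
    by exists N => y; exact: PN.
  apply: cpt => y y01.
  have p0 : 0 < Psi y / 12 by rewrite divr_gt0// Psi0.
  (* The point y serves as centre for all y' nearby: the distance takes less than half of Psi y, and
     six times a twelfth takes the other half. *)
  exists (ball y (Psi y / 2), [set n | 1 / 2 ^+ n < Psi y / 12]).
    split; last exact: near_infty_natSinv_expn_lt (PosNum p0).
    by apply: nbhsx_ballx; rewrite divr_gt0// Psi0.
  move=> [y' n] /= []; rewrite -ball_normE /= distrC => yy' nP.
  by exists y => //; lra.
have /choice[F FP] : forall j : nat, exists f : baire, (j <= 2 ^ N)%N ->
    exists2 x : R, x \in `[0, 1] & represents (digits_code f) x /\
      `|j%:R / 2 ^+ N - x| + 6 / 2 ^+ N < Psi x.
  move=> j; have [jN|] := leqP j (2 ^ N); last by exists id.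
  have [|x x01 xP] := PN (j%:R / 2 ^+ N).
    rewrite in_itv /= divr_ge0 ?exprn_ge0//= ler_pdivrMr ?exprn_gt0// mul1r.
    by rewrite -natrX ler_nat.
  by have [f fx] := real_digits_code x01; exists f => _; exists x.
(* The precision and all digit sequences are packed into one witness, in the layout read by
   [center_digits]. *)
pose w n := if n is m.+1 then let: (i, k) := Cantor.of_nat m in F i k else N.
have wF j : center_digits w j = F j.
  by apply: funext => n; rewrite /center_digits /w /npair Cantor.cancel_of_to.
exists w; rewrite /cover_witness big1 => // -[j /= jN] _; apply/eqP.
rewrite excess_eq0 wF /=; have [x x01 [xj xP]] := FP j jN.
have := represents_dist N (ZPsi _ _ x01 xj).
have := represents_dist N xj.
rewrite rat_of_digits_code fmorph_div rmorphXn /= !rmorph_nat.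
set m := (digit_prefix _ _)%:R; set q := ratr _; set e := 2 ^+ N in xP *.
have e0 : 0 < e by rewrite exprn_gt0.
have -> : (`|j%:R - m| + 4) / e = `|j%:R / e - m / e| + 4 / e.
  by rewrite mulrDl -mulrBl normrM normfV (gtr0_norm e0).
move=> xm qPsi; have := ler_distD x (j%:R / e) (m / e).
have qPsi' := ler_norm (Psi x - q).
rewrite [`|x - m / e|]distrC; rewrite distrC in qPsi.
lra.
Qed.

(** * The net of witnesses *)

Definition cover_net Z : net R :=
  Net [set w | cover_witness Z w = 1%N] (fun a b => (b 0 <= a 0)%N)
      (fun w => 2 ^- w 0%N).

Lemma codes_cover_net Z : codes_net (cover_net_code Z) (cover_net Z).
Proof.
split=> [d //|a b _ _|d _] /=.
  by rewrite /cover_net_code /bjoin /=; split; lia.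
rewrite /cover_net_code /=.
have codeE : rat_of_code (npair (npair 1 0) (2 ^ d 0%N).-1) = 2 ^- d 0%N.
  rewrite /rat_of_code /npair !Cantor.cancel_of_to subr0 div1r.
  by rewrite prednK ?expn_gt0// natrX.
split=> [n i|]; first by rewrite subrr normr0 invr_gt0 exprn_gt0.
rewrite codeE fmorphV rmorphXn /= rmorph_nat.
exact: cvg_cst.
Qed.

Lemma cover_net_minimal Z : (exists w, cover_witness Z w = 1%N) ->
  exists2 w, cover_witness Z w = 1%N &
    forall v, cover_witness Z v = 1%N -> (w 0 <= v 0)%N.
Proof.
move=> [w0 w0P].
have ex : exists n, `[< exists2 w, cover_witness Z w = 1%N & w 0%N = n >].
  by exists (w0 0%N); apply/asboolP; exists w0.
case: (ex_minnP ex) => n /asboolP[w wP <-] wmin; exists w => // v vP.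
by apply: wmin; apply/asboolP; exists v.
Qed.

(** Directedness holds because precisions are linearly ordered: of two witnesses, the one with the
    smaller precision is an upper bound. *)
Lemma cover_net_in_unit Z :
  (exists w, cover_witness Z w = 1%N) -> net_in_unit (cover_net Z).
Proof.
move=> [w wP]; split; last first.
  move=> d _; rewrite in_itv /= invr_ge0 exprn_ge0//=.
  by rewrite invf_le1 ?exprn_gt0// exprn_ege1// ler1n.
split=> //=; first by exists w.
- by move=> a b c _ _ _ ab bc; exact: leq_trans bc ab.
- move=> a b aP bP; have [ab|/ltnW ba] := leqP (a 0%N) (b 0%N).
    by exists a.
  by exists b.
Qed.

Lemma cover_net_monotone Z : net_monotone (cover_net Z).
Proof.
move=> a b _ _ /= ba; rewrite lef_pV2 ?posrE ?exprn_gt0//.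
by rewrite ler_weXn2l// ler1n.
Qed.

(** Beyond a witness of least precision the net is constant. *)
Lemma cover_net_limit Z w : cover_witness Z w = 1%N ->
  (forall v, cover_witness Z v = 1%N -> (w 0 <= v 0)%N) ->
  net_limit (cover_net Z) (2 ^- w 0%N).
Proof.
move=> wP wmin e e0; exists w; split => // d dP /= dw.
suff -> : d 0%N = w 0%N by rewrite subrr normr0.
by apply/eqP; rewrite eqn_leq dw wmin.
Qed.

(** A witness of least precision lies above every index, so its own value is within every positive
    distance of [l]; the distance between the two, if positive, would be less than itself. *)
Lemma cover_net_limit_unique Z w l : cover_witness Z w = 1%N ->
  (forall v, cover_witness Z v = 1%N -> (w 0 <= v 0)%N) ->
  net_limit (cover_net Z) l -> l = 2 ^- w 0%N.
Proof.
move=> wP wmin lP; apply/eqP; rewrite eq_sym -subr_eq0 -normr_eq0.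
apply/negPn/negP; rewrite -normr_gt0 normr_id => /lP[d [dP]].
by move=> /(_ w wP (wmin d dP)) /=; rewrite ltxx.
Qed.

(** * The two reductions *)

Lemma HBU_cover_of_modulus Z x :
  monotone_net_modulus R (cover_net_code Z) x -> HBU R Z (cover_of_modulus x).
Proof.
move=> xP Psi ZPsi Psi0; have ex := cover_witness_exists ZPsi Psi0.
have [w wP wmin] := cover_net_minimal ex.
have [d dx /(_ 0%N)[/= dP _]] := xP _ _ (codes_cover_net Z)
  (cover_net_in_unit ex) (@cover_net_monotone Z) (cover_net_limit wP wmin).
have {dx} dE : d 0%N = fun n => x (npair 0 n) by apply: funext => n; exact: dx.
move: dP; rewrite {}dE; set v := fun n => _ => vP.
(* The centres are chosen simultaneously, with default 0 for indices beyond the grid. *)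
have /choice[c cP] : forall j : nat, exists y : R, (j <= 2 ^ v 0)%N ->
    [/\ y \in `[0, 1], represents (digits_code (center_digits v j)) y &
    forall z : R, `|z - j%:R / 2 ^+ v 0%N| < 2 / 2 ^+ v 0%N ->
      ball y (Psi y) z].
  move=> j; have [jN|] := leqP j (2 ^ v 0); last by exists 0.
  by have [y yP] := cover_witness_ball ZPsi vP jN; exists y.
exists (2 ^ v 0)%N, c; split.
- split=> // i iN; have [_ + _] := cP i iN.
  congr (represents _ _); apply: funext => n.
  by rewrite /cover_of_modulus /= /npair Cantor.cancel_of_to.
- by move=> i iN; have [] := cP i iN.
- move=> z /= z01; have [j jN zj] := dyadic_grid (v 0%N) z01.
  exists j => //=; have [_ _] := cP j jN; apply.
  rewrite (le_lt_trans zj)// ltr_pMl ?invr_gt0 ?exprn_gt0//.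
  by rewrite ltr1n.
Qed.

(** The factor 2 in the witness condition pays for two distances of at most 2^-N: from a point of Y
    to another one, and from there to the grid. *)
Lemma lebesgue_number_limit Z x :
  monotone_net_limit R (cover_net_code Z) x -> lebesgue_number_lemma R Z x.
Proof.
move=> xP Psi ZPsi Psi0; have ex := cover_witness_exists ZPsi Psi0.
have [w wP wmin] := cover_net_minimal ex.
have [l xl /(cover_net_limit_unique wP wmin) lE] := xP _ (codes_cover_net Z)
  (cover_net_in_unit ex) (@cover_net_monotone Z).
exists l => //; rewrite {}lE {xl l}.
split=> [|Y Y01 supY]; first by rewrite invr_gt0 exprn_gt0.
have [->|/set0P[y Yy]] := eqVneq Y set0.
  by exists 0; [rewrite in_itv /= lexx ler01|].
have [j jN yj] := dyadic_grid (w 0%N) (Y01 y Yy).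
have [c [c01 _ cP]] := cover_witness_ball ZPsi wP jN.
exists c => // z Yz; apply: cP.
have zy : `|z - y| < 2 ^- w 0%N.
  (* The supremum dominates each distance because the distances within Y are bounded by 1. *)
  apply: le_lt_trans supY; apply: ub_le_sup; last by exists z => //; exists y.
  exists 1 => _ [a Ya [b Yb <-]].
  have := Y01 a Ya; have := Y01 b Yb; rewrite /= !in_itv /= ler_norml.
  by lra.
have := ler_distD y z (j%:R / 2 ^+ w 0%N); lra.
Qed.

End Cover.

Theorem theorem2 (R : realType) :
  muN_reduces (HBU R) (monotone_net_modulus R) /\
  strongly_muN_reduces (lebesgue_number_lemma R) (monotone_net_limit R).
Proof.
have [t tE] := cover_net_code_term; have [s sE] := cover_of_modulus_term.
split.
  exists (pickle lookup_machine), s, t => Z x; rewrite tE sE => xP.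
  exists (cover_of_modulus x); split; first exact: lookup_machineP.
  exact: HBU_cover_of_modulus.
(* The identity term: the limit is already the Lebesgue number, which makes the reduction strong. *)
exists (pickle lookup_machine), (TLam (TVar (Var0 _ _))), t => Z x.
rewrite tE => xP; exists x; split; first exact: lookup_machineP.
exact: lebesgue_number_limit.
Qed.
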